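(* Let $n=2$, let $p=q$, let $\mu\in\mathbb{R}^{p^2}$, let $\Gamma,\Psi\in\mathcal{M}_{p,p}(\mathbb{R})$ be symmetric positive definite, and let $X_1,X_2$ be independent random matrices in $\mathcal{M}_{p,p}(\mathbb{R})$ with $\mathrm{vec}(X_k)\sim\mathcal{N}(\mu,\Psi\otimes\Gamma)$, $k=1,2$. Then $X_1-X_2$ is invertible with probability $1$, and whenever $X_1-X_2$ is invertible, the set of maximum likelihood estimators of the covariance matrix equals $$\Big\{\Psi'\otimes\Gamma' : \Psi'\in\mathcal{M}_{p,p}(\mathbb{R})\text{ symmetric positive definite},\ \Gamma'=\tfrac1p\big(\tfrac12X_1-\tfrac12X_2\big)(\Psi')^{-1}\big(\tfrac12X_1-\tfrac12X_2\big)^T\Big\}.$$ Hence, if $n=2$, $p=q$ and $X_1-X_2$ is invertible, the maximum likelihood estimator of $\Psi\otimes\Gamma$ is not unique.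
   Context: $\mathcal{M}_{p,q}(\mathbb{R})$ is the set of real $p\times q$ matrices, $\mathrm{vec}$ stacks the columns of a matrix into one vector, and $\otimes$ is the Kronecker product. The parameters $\mu,\Gamma,\Psi$ are unknown. The likelihood function, for $M\in\mathcal{M}_{p,q}(\mathbb{R})$ (with $\mathrm{vec}(M)$ the mean vector) and symmetric positive definite $\Gamma\in\mathcal{M}_{p,p}(\mathbb{R})$, $\Psi\in\mathcal{M}_{q,q}(\mathbb{R})$, is $$L(M,\Gamma,\Psi)=(2\pi)^{-\frac12 pqn}|\Gamma|^{-\frac12 qn}|\Psi|^{-\frac12 pn}\exp\Big(-\tfrac12\,\mathrm{trace}\Big(\Psi^{-1}\sum_{k=1}^n (X_k-M)^T\Gamma^{-1}(X_k-M)\Big)\Big),$$ where $|A|$ is the determinant of $A$. It depends on $(\Gamma,\Psi)$ only through $\Psi\otimes\Gamma$. A maximum likelihood estimator of $\Psi\otimes\Gamma$ is a matrix $\hat\Psi\otimes\hat\Gamma$ with $\hat\Gamma,\hat\Psi$ symmetric positive definite such that $L$ attains its global maximum, over all $M\in\mathcal{M}_{p,q}(\mathbb{R})$ and all symmetric positive definite $\Gamma,\Psi$, at $(\hat M,\hat\Gamma,\hat\Psi)$, where $\hat M=\frac1n\sum_{k=1}^n X_k$. It is unique if there is exactly one such matrix $\hat\Psi\otimes\hat\Gamma$ (uniqueness concerns the Kronecker product, not the two factors separately).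
   Formalization: The final non-uniqueness claim is stated only for p ≥ 2: for p = 1 every Ψ'⊗Γ' in the displayed set equals ((X_1−X_2)/2)^2, so the maximum likelihood estimator is unique there and the original sentence fails. *)

(* Defs.v *)
From HB Require Import structures.
From mathcomp Require Export all_boot all_order all_algebra.
From mathcomp Require Export all_classical all_reals all_analysis.
From mathcomp Require Export mxtens.

Set Implicit Arguments.
Unset Strict Implicit.
Unset Printing Implicit Defensive.

Export Order.TTheory GRing.Theory Num.Theory.
Export numFieldNormedType.Exports.

#[global] Open Scope classical_set_scope.
#[global] Open Scope ring_scope.

(* [vec M] stacks the columns of [M]: entry (i, j) of the p x q matrix [M] goes
   to position j * p + i.  This is the indexing for which
   Psi *t Gamma (Kronecker product, mxtens) acts as
   vec M |-> vec (Gamma *m M *m Psi^T). *)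
Definition vec (R : realType) (p q : nat) (M : 'M[R]_(p, q)) : 'cV[R]_(q * p) :=
  \col_k M (mxtens_unindex k).2 (mxtens_unindex k).1.

Definition spd (R : realType) (n : nat) (A : 'M[R]_n) : Prop :=
  A^T = A /\ forall v : 'cV[R]_n, v != 0 -> 0 < (v^T *m A *m v) ord0 ord0.

(* R^m carries its product sigma-algebra through [m.-tuple R]. *)
Definition coords (R : realType) (m : nat) (v : 'cV[R]_m) : m.-tuple R :=
  [tuple v i ord0 | i < m].

Definition of_coords (R : realType) (m : nat) (t : m.-tuple R) : 'cV[R]_m :=
  \col_i tnth t i.

Definition tuple_cons (R : realType) (m : nat) (tx : m.-tuple R * R) :
  m.+1.-tuple R := [tuple of tx.2 :: tx.1].

Section lebesgue_tuple_step.
Context (R : realType) (m : nat) (mu : {measure set (m.-tuple R) -> \bar R}).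

Definition lebesgue_tupleS : set (m.+1.-tuple R) -> \bar R :=
  pushforward (mu \x lebesgue_measure)%E (@tuple_cons R m).

Let mcons : measurable_fun [set: m.-tuple R * R] (@tuple_cons R m).
Proof. exact: measurable_cons. Qed.

Let lebesgue_tupleS0 : lebesgue_tupleS set0 = 0%E.
Proof. exact: measure0. Qed.

Let lebesgue_tupleS_ge0 A : (0 <= lebesgue_tupleS A)%E.
Proof. exact: measure_ge0. Qed.

Let lebesgue_tupleS_sigma_additive : semi_sigma_additive lebesgue_tupleS.
Proof. exact: measure_semi_sigma_additive. Qed.

HB.instance Definition _ := isMeasure.Build _ _ _ lebesgue_tupleS
  lebesgue_tupleS0 lebesgue_tupleS_ge0 lebesgue_tupleS_sigma_additive.

End lebesgue_tuple_step.

(* Lebesgue measure on R^m: the m-fold product of [lebesgue_measure], moved from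
   nested pairs to tuples along [tuple_cons]. *)
Fixpoint lebesgue_tuple (R : realType) (m : nat) :
    {measure set (m.-tuple R) -> \bar R} :=
  if m is m'.+1 then lebesgue_tupleS (lebesgue_tuple R m') else \d_ [tuple].

Definition mvnormal_pdf (R : realType) (m : nat) (mu : 'cV[R]_m)
    (Sigma : 'M[R]_m) (x : 'cV[R]_m) : R :=
  (2 * pi) `^ (- (m%:R / 2)) * (\det Sigma) `^ (- 2^-1) *
  expR (- 2^-1 * ((x - mu)^T *m invmx Sigma *m (x - mu)) ord0 ord0).

(* Y ~ N(mu, Sigma), for positive definite Sigma: the law of Y has density
   [mvnormal_pdf mu Sigma] with respect to Lebesgue measure. *)
Definition mvnormal (d : measure_display) (T : measurableType d) (R : realType)
    (P : probability T R) (m : nat) (Y : T -> 'cV[R]_m)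
    (mu : 'cV[R]_m) (Sigma : 'M[R]_m) : Prop :=
  measurable_fun [set: T] (fun w => coords (Y w)) /\
  forall B : set (m.-tuple R), measurable B ->
    P [set w | B (coords (Y w))] =
    (\int[lebesgue_tuple R m]_(t in B) (mvnormal_pdf mu Sigma (of_coords t))%:E)%E.

Definition independent2 (d : measure_display) (T : measurableType d)
    (R : realType) (P : probability T R) (m : nat) (Y1 Y2 : T -> 'cV[R]_m) :
    Prop :=
  forall A B : set (m.-tuple R), measurable A -> measurable B ->
    P [set w | A (coords (Y1 w)) /\ B (coords (Y2 w))] =
    (P [set w | A (coords (Y1 w))] * P [set w | B (coords (Y2 w))])%E.

Definition likelihood (R : realType) (n p q : nat) (X : 'I_n -> 'M[R]_(p, q))
    (M : 'M[R]_(p, q)) (Gamma : 'M[R]_p) (Psi : 'M[R]_q) : R :=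
  (2 * pi) `^ (- ((p * q * n)%:R / 2)) *
  (\det Gamma) `^ (- ((q * n)%:R / 2)) *
  (\det Psi) `^ (- ((p * n)%:R / 2)) *
  expR (- 2^-1 *
    \tr (invmx Psi *m \sum_k ((X k - M)^T *m invmx Gamma *m (X k - M)))).

Definition sample_mean (R : realType) (n p q : nat) (X : 'I_n -> 'M[R]_(p, q)) :
    'M[R]_(p, q) := n%:R^-1 *: \sum_k X k.

(* S is a maximum likelihood estimator of the covariance matrix Psi *t Gamma. *)
Definition is_mle (R : realType) (n p q : nat) (X : 'I_n -> 'M[R]_(p, q))
    (S : 'M[R]_(q * p)) : Prop :=
  exists (Gamma : 'M[R]_p) (Psi : 'M[R]_q),
    [/\ spd Gamma, spd Psi, S = Psi *t Gamma &
        forall (M : 'M[R]_(p, q)) (Gamma' : 'M[R]_p) (Psi' : 'M[R]_q),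
          spd Gamma' -> spd Psi' ->
          likelihood X M Gamma' Psi' <=
          likelihood X (sample_mean X) Gamma Psi].

Definition mle_unique (R : realType) (n p q : nat)
    (X : 'I_n -> 'M[R]_(p, q)) : Prop :=
  exists! S : 'M[R]_(q * p), is_mle X S.

(* Main.v *)
From mathcomp Require Import ring measurable_realfun.
Require Import Defs.

Set Implicit Arguments.
Unset Strict Implicit.
Unset Printing Implicit Defensive.

(* A Cholesky factorization gives [\det A * expR (p - \tr A) <= 1] for positive
   definite [A], with equality only at the identity.  With H = (X_1 - X_2) / 2,
   the likelihood at (M, Gamma, Psi) is a constant times the p-th power of
   [\det W * expR (p - \tr W)], where W = Gamma^-1 (H Psi^-1 H^T / p), times a
   factor at most 1 which is 1 at the sample mean.  Hence the maximum is
   reached, for every Psi, exactly when Gamma = H Psi^-1 H^T / p.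

   For the almost sure invertibility, [\det (s - t)] is, for fixed s, a function
   of t which is polynomial along every line and not identically zero; the zeros
   of such a function are Lebesgue-null, by Fubini and induction on the
   dimension.
   Since the laws are absolutely continuous and independent, a second use of
   Fubini shows that X_1 - X_2 is almost surely invertible. *)

(** * Positive definite matrices *)

(** The rectangular form serves the Cholesky induction, where [B] has one more row than columns. *)
Lemma spd_congr (R : realType) (m n : nat) (A : 'M[R]_m) (B : 'M[R]_(m, n)) :
  (forall v : 'cV[R]_n, B *m v = 0 -> v = 0) ->
  spd A -> spd (B^T *m A *m B).
Proof.
move=> injB [symA posA]; split=> [|v v0].
  by rewrite !trmx_mul trmxK symA mulmxA.
have := posA (B *m v); rewrite trmx_mul !mulmxA; apply.
by apply: contra v0 => /eqP/injB ->.
Qed.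

Lemma spd_unitmx (R : realType) (n : nat) (A : 'M[R]_n) :
  spd A -> A \in unitmx.
Proof.
move=> [_ posA]; rewrite unitmxE unitfE; apply/negP => /det0P[v v0 vA].
have /posA : v^T != 0 by apply: contra v0; rewrite trmx_eq0.
by rewrite trmxK vA mul0mx mxE ltxx.
Qed.

Lemma spd_congr_unitmx (R : realType) (n : nat) (A B : 'M[R]_n) :
  B \in unitmx -> spd A -> spd (B^T *m A *m B).
Proof.
move=> uB; apply: spd_congr => v Bv.
by rewrite -(mulKmx uB v) Bv mulmx0.
Qed.

(** By symmetry [invmx A] is the congruence of [A] by [invmx A] itself. *)
Lemma spd_invmx (R : realType) (n : nat) (A : 'M[R]_n) :
  spd A -> spd (invmx A).
Proof.
move=> sA; have uA := spd_unitmx sA.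
rewrite -[invmx A]mul1mx -[1%:M]trmx1 -(mulmxV uA) trmx_mul sA.1.
by apply: spd_congr_unitmx; rewrite ?unitmx_inv.
Qed.

Lemma spd_scale (R : realType) (n : nat) (a : R) (A : 'M[R]_n) :
  0 < a -> spd A -> spd (a *: A).
Proof.
move=> a0 [symA posA]; split=> [|v v0]; first by rewrite linearZ /= symA.
by rewrite -scalemxAr -scalemxAl mxE mulr_gt0// posA.
Qed.

Lemma spd1 (R : realType) (n : nat) : spd (1%:M : 'M[R]_n).
Proof.
split=> [|v v0]; first exact: trmx1.
rewrite mulmx1 mxE; have [i vi0] : exists i, v i ord0 != 0.
  apply/existsP; apply: contraR v0; rewrite negb_exists => /forallP v0.
  apply/eqP/matrixP => i j; rewrite ord1 mxE.
  by have := v0 i; rewrite negbK => /eqP.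
rewrite (bigD1 i)//= ltr_pwDl//.
  by rewrite mxE -expr2 exprn_even_gt0.
by apply: sumr_ge0 => j _; rewrite mxE -expr2 sqr_ge0.
Qed.

Lemma spd_diag_gt0 (R : realType) (n : nat) (A : 'M[R]_n) (i : 'I_n) :
  spd A -> 0 < A i i.
Proof.
move=> [_ /(_ (delta_mx i ord0))].
rewrite trmx_delta -rowE -colE !mxE; apply.
apply/negP => /eqP/matrixP/(_ i ord0)/eqP; rewrite !mxE !eqxx.
by rewrite oner_eq0.
Qed.

(** Induction on the size: after splitting off the first row and column, the Schur complement of the
    corner [a] is again positive definite and is factored by induction. *)
Lemma spd_cholesky (R : realType) (n : nat) (A : 'M[R]_n) :
  spd A -> exists2 L : 'M[R]_n, is_trig_mx L & A = L *m L^T.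
Proof.
elim: n A => [|n IHn] A sA.
  by exists 0; [exact: mx0_is_trig | rewrite [A]flatmx0 [_ *m _]flatmx0].
change ('M[R]_(1 + n)) in A.
pose a := A ord0 ord0; pose b : 'cV[R]_n := dlsubmx A; pose C := drsubmx A.
have EA : A = block_mx a%:M b^T b C.
  rewrite -[LHS](@submxK _ 1 n 1 n); congr block_mx.
    apply/matrixP => i j; rewrite !ord1 !mxE eqxx mulr1n /a.
    by congr (A _ _); apply: val_inj.
  by rewrite /b trmx_dlsub; congr ursubmx; exact/esym/sA.1.
have a0 : 0 < a := spd_diag_gt0 ord0 sA.
have sS : spd (C - a^-1 *: (b *m b^T)).
  (* [B *m v] has tail [v] and the head that minimizes the quadratic form of [A]; the minimum is the
     value of the Schur complement at [v]. *)
  pose B : 'M[R]_(1 + n, n) := col_mx (- a^-1 *: b^T) 1%:M.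
  have -> : C - a^-1 *: (b *m b^T) = B^T *m A *m B.
    rewrite EA /B tr_col_mx mul_row_block mul_row_col trmx1 !mul1mx mulmx1.
    have -> : (- a^-1 *: b^T)^T = - a^-1 *: b by rewrite linearZ/= trmxK.
    rewrite mul_mx_scalar scalerA mulrN mulfV ?gt_eqF//.
    by rewrite scaleN1r addNr mul0mx add0r -scalemxAl scaleNr addrC.
  apply: (spd_congr _ sA) => v.
  rewrite (@mul_col_mx _ 1 n n 1) mul1mx => /eqP.
  by rewrite (@col_mx_eq0 _ 1 n 1) => /andP[_ /eqP].
have [L tL EL] := IHn _ sS.
have s0 : Num.sqrt a != 0 by rewrite sqrtr_eq0 -ltNge.
(* The first column reproduces [a] and [b], and adds to the lower right block exactly the term that
   the Schur complement subtracts. *)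
exists (block_mx (Num.sqrt a)%:M 0 ((Num.sqrt a)^-1 *: b) L).
  suff : @is_trig_mx R (1 + n) (1 + n)
    (block_mx (Num.sqrt a)%:M 0 ((Num.sqrt a)^-1 *: b) L) by [].
  by rewrite is_trig_block_mx// tL eqxx scalar_mx_is_trig.
rewrite (@tr_block_mx _ 1 n 1 n) (@mulmx_block _ 1 n 1 n 1 n) EA.
rewrite tr_scalar_mx -scalar_mxM -expr2 sqr_sqrtr ?ltW//.
rewrite trmx0 mul0mx mulmx0 !addr0 linearZ/= -scalemxAr mul_scalar_mx.
rewrite scalerA mulVf// scale1r mul_mx_scalar scalerA mulfV// scale1r.
rewrite -scalemxAl -scalemxAr scalerA -invfM -expr2 sqr_sqrtr ?ltW//.
by rewrite -EL mul0mx addr0 addrC subrK.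
Qed.

Lemma spd_factor (R : realType) (n : nat) (A : 'M[R]_n) :
  spd A -> exists2 L : 'M[R]_n, L \in unitmx & A = L *m L^T.
Proof.
move=> sA; have [L _ EA] := spd_cholesky sA; exists L => //.
by have := spd_unitmx sA; rewrite EA unitmx_mul => /andP[].
Qed.

Lemma spd_det_gt0 (R : realType) (n : nat) (A : 'M[R]_n) :
  spd A -> 0 < \det A.
Proof.
move=> /spd_factor[L uL ->]; rewrite det_mulmx det_tr -expr2.
by rewrite exprn_even_gt0//= -unitfE -unitmxE.
Qed.

(** * The determinant-trace inequality *)

Lemma le_expRB1 (R : realType) (x : R) : x <= expR (x - 1).
Proof. by have := expR_ge1Dx (x - 1); rewrite addrC subrK. Qed.

Lemma expRB1_id (R : realType) (x : R) : expR (x - 1) <= x -> x = 1.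
Proof.
move=> h; apply/eqP; rewrite -subr_eq0; apply: contraTT h => x1.
by rewrite -ltNge; have := expR_gt1Dx x1; rewrite addrC subrK.
Qed.

(* With a Cholesky factor [L] of [A], the left-hand side of the inequality is
   the product over the rows of the numbers
   [L i i ^+ 2 * expR (1 - \sum_j L i j ^+ 2)], each at most 1. *)
Lemma spd_det_expR_tr (R : realType) (n : nat) (A : 'M[R]_n) : spd A ->
  \det A * expR (n%:R - \tr A) <= 1 ?= iff (A == 1%:M).
Proof.
move=> sA; have [L tL EA] := spd_cholesky sA.
pose s i := \sum_j L i j ^+ 2; pose r i := L i i ^+ 2 * expR (1 - s i).
have Ls i : L i i ^+ 2 <= s i.
  by rewrite /s (bigD1 i)//= lerDl sumr_ge0// => j _; rewrite sqr_ge0.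
have r0 i : 0 <= r i by rewrite mulr_ge0 ?sqr_ge0 ?expR_ge0.
have r1 i : r i <= 1.
  rewrite /r -opprB expRN ler_pdivrMr ?expR_gt0// mul1r.
  exact: le_trans (Ls i) (le_expRB1 _).
have prodr : \det A * expR (n%:R - \tr A) = \prod_i r i.
  rewrite big_split/= -expR_sum sumrB sumr_const card_ord.
  congr (_ * expR (_ - _)).
    by rewrite EA det_mulmx det_tr det_trig// -expr2 prodrXl.
  rewrite EA; apply: eq_bigr => i _; rewrite mxE; apply: eq_bigr => j _.
  by rewrite mxE expr2.
split; first by rewrite prodr; apply: prodr_ile1 => i; rewrite r0 r1.
apply/eqP/eqP => [|->]; last by rewrite det1 mxtrace1 subrr expR0 mulr1.
rewrite prodr => prod1.
have ri i : r i = 1.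
  apply/eqP; rewrite eq_le r1/= -{1}prod1 (bigD1 i)//= ler_piMr//.
  by apply: prodr_ile1 => j; rewrite r0 r1.
have Es i : L i i ^+ 2 = expR (s i - 1).
  apply: (mulIf (x := expR (1 - s i))); first by rewrite gt_eqF ?expR_gt0.
  by rewrite [LHS]ri -expRD -[1 - s i]opprB subrr expR0.
(* Since [L i i ^+ 2] is at most [s i], equality in [r i <= 1] makes the exponential bound tight at
   [s i]. *)
have s1 i : s i = 1 by apply: expRB1_id; rewrite -Es.
(* The diagonal entry alone already exhausts the row sum of squares, which is 1. *)
have Loff i j : j != i -> L i j = 0.
  move=> ji; apply/eqP; rewrite -sqrf_eq0.
  have := s1 i; rewrite /s (bigD1 i)//= Es s1 subrr expR0.
  move=> /(canRL (addKr _)); rewrite addNr => /eqP.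
  rewrite psumr_eq0; last by move=> k _; rewrite sqr_ge0.
  by move=> /allP/(_ j); rewrite mem_index_enum ji => /(_ isT).
rewrite EA; apply/matrixP => i j; rewrite !mxE.
have [<-|ij] := eqVneq i j.
  by rewrite -[RHS](s1 i); apply: eq_bigr => k _; rewrite mxE expr2.
rewrite big1// => k _; rewrite mxE; have [->|ki] := eqVneq k i.
  by rewrite (Loff j)// mulr0.
by rewrite (Loff i k)// mul0r.
Qed.

(** With [B = C *m C^T], cyclicity turns the trace into a sum of values of the quadratic form of [A]
    at the columns of [N *m C]. *)
Lemma mxtrace_spd_ge0 (R : realType) (m n : nat) (A : 'M[R]_m) (B : 'M[R]_n)
  (N : 'M[R]_(m, n)) : spd A -> spd B -> 0 <= \tr (B *m (N^T *m A *m N)).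
Proof.
move=> sA /spd_factor[C _ ->]; rewrite -mulmxA mxtrace_mulC.
have -> : C^T *m (N^T *m A *m N) *m C = (N *m C)^T *m A *m (N *m C).
  by rewrite trmx_mul !mulmxA.
apply: sumr_ge0 => i _; set V := N *m C.
have -> : (V^T *m A *m V) i i = ((col i V)^T *m A *m col i V) ord0 ord0.
  rewrite !mxE; apply: eq_bigr => k _; rewrite !mxE; congr (_ * _).
  by apply: eq_bigr => l _; rewrite !mxE.
have [->|v0] := eqVneq (col i V) 0; first by rewrite mulmx0 mxE.
exact/ltW/sA.2.
Qed.

(** * The likelihood of two square samples *)

(** [invmx G *m S] need not be symmetric, but for [G = L *m L^T] it has the same trace and
    determinant as the congruence of [S] by [invmx L^T], which is positive definite. *)
Lemma spd_ratio_le1 (R : realType) (n : nat) (G S : 'M[R]_n) :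
  spd G -> spd S ->
  \det (invmx G *m S) * expR (n%:R - \tr (invmx G *m S)) <= 1 ?= iff (G == S).
Proof.
move=> /spd_factor[L uL ->] sS.
pose B : 'M[R]_n := invmx L^T.
have uB : B \in unitmx by rewrite unitmx_inv unitmx_tr.
have BT : B^T = invmx L by rewrite /B trmx_inv trmxK.
have BL : L^T *m B = 1%:M by rewrite mulmxV// unitmx_tr.
have EL : invmx (L *m L^T) = B *m B^T.
  have uLL : L *m L^T \in unitmx by rewrite unitmx_mul unitmx_tr uL.
  apply: (can_inj (mulKmx uLL)).
  by rewrite mulmxV// mulmxA -[L *m L^T *m B]mulmxA BL mulmx1 BT mulmxV//.
have h := spd_det_expR_tr (spd_congr_unitmx uB sS).
rewrite EL -mulmxA mxtrace_mulC.
have -> : \det (B *m (B^T *m S)) = \det (B^T *m S *m B).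
  by rewrite det_mulmx mulrC -det_mulmx.
suff -> : (L *m L^T == S) = (B^T *m S *m B == 1%:M) by [].
apply/eqP/eqP => [<-|E1].
  by rewrite BT !mulmxA mulVmx// mul1mx.
have -> : S = L *m (B^T *m S *m B) *m L^T.
  by rewrite !mulmxA BT mulmxV// mul1mx -mulmxA /B mulVmx ?mulmx1// unitmx_tr.
by rewrite E1 mulmx1.
Qed.

(** The two centered samples are [N + H] and [N - H], so the cross terms cancel. *)
Lemma sum_centered_quad (R : realType) (p : nat) (X : 'I_2 -> 'M[R]_p)
    (M G : 'M[R]_p) :
  let H := 2^-1 *: X 0 - 2^-1 *: X 1 in
  let N := sample_mean X - M in
  \sum_k ((X k - M)^T *m G *m (X k - M)) =
  2 *: (H^T *m G *m H + N^T *m G *m N).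
Proof.
have l1 : lift ord0 ord0 = 1 :> 'I_2 by exact: val_inj.
have o0 : ord0 = 0 :> 'I_2 by exact: val_inj.
move=> H N; rewrite big_ord_recl big_ord1 l1 o0.
have -> : X 0 - M = N + H.
  rewrite /N /H /sample_mean big_ord_recl big_ord1 l1 o0.
  by apply/matrixP => i j; rewrite !mxE; field.
have -> : X 1 - M = N - H.
  rewrite /N /H /sample_mean big_ord_recl big_ord1 l1 o0.
  by apply/matrixP => i j; rewrite !mxE; field.
have trD (A B : 'M[R]_p) : (A + B)^T = A^T + B^T by rewrite linearD.
have trN (A : 'M[R]_p) : (- A)^T = - A^T by rewrite linearN.
clearbody N H.
rewrite !trD trN !mulmxDl !mulmxDr !mulNmx !mulmxN opprK.
move: (N^T *m G *m N) (N^T *m G *m H) (H^T *m G *m N) (H^T *m G *m H).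
move=> a b c e.
by apply/matrixP => i j; rewrite !mxE; ring.
Qed.

Lemma powRN_half (R : realType) (p : nat) (x : R) : 0 <= x ->
  x `^ (- ((p * 2)%:R / 2)) = (x ^+ p)^-1.
Proof.
by move=> x0; rewrite natrM mulfK ?pnatr_eq0// powRN powR_mulrn.
Qed.

(** * Profile likelihood and its maximum *)

Definition half_diff (R : realType) (p : nat) (X : 'I_2 -> 'M[R]_p) : 'M[R]_p :=
  2^-1 *: X 0 - 2^-1 *: X 1.

(** For [H = half_diff X] invertible and [Psi] positive definite, this is the maximizer of the
    likelihood in [Gamma] when [Psi] is held fixed. *)
Definition profile_Gamma (R : realType) (p : nat) (H Psi : 'M[R]_p) : 'M[R]_p :=
  p%:R^-1 *: (H *m invmx Psi *m H^T).

Lemma spd_profile_Gamma (R : realType) (p : nat) (H Psi : 'M[R]_p) :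
  (0 < p)%N -> H \in unitmx -> spd Psi -> spd (profile_Gamma H Psi).
Proof.
move=> p0 uH sPsi; apply: spd_scale; first by rewrite invr_gt0 ltr0n.
rewrite -{1}[H]trmxK; apply: spd_congr_unitmx; first by rewrite unitmx_tr.
exact: spd_invmx.
Qed.

(** The likelihood at the sample mean and [profile_Gamma H Psi]; [Psi] drops out because the
    determinants of [Psi] and [profile_Gamma H Psi] have product [p%:R^-1 ^+ p * \det H ^+ 2]. *)
Definition likelihood_max (R : realType) (p : nat) (H : 'M[R]_p) : R :=
  (2 * pi) `^ (- ((p * p * 2)%:R / 2)) *
  ((p%:R^-1 ^+ p * \det H ^+ 2) ^+ p)^-1 * expR (- p%:R) ^+ p.

Lemma likelihood_max_gt0 (R : realType) (p : nat) (H : 'M[R]_p) :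
  (0 < p)%N -> H \in unitmx -> 0 < likelihood_max H.
Proof.
move=> p0; rewrite unitmxE unitfE => H0.
rewrite !mulr_gt0 ?powR_gt0 ?mulr_gt0 ?pi_gt0 ?exprn_gt0 ?expR_gt0//.
rewrite invr_gt0 exprn_gt0//; apply: mulr_gt0; last by rewrite exprn_even_gt0.
by rewrite exprn_gt0// invr_gt0 ltr0n.
Qed.

(** By cyclicity the dispersion trace is [p%:R * \tr W], and [\det W] is a constant divided by
    [\det Gamma * \det Psi]. Only the last factor involves [M]. *)
Lemma likelihoodE (R : realType) (p : nat) (X : 'I_2 -> 'M[R]_p)
    (M Gamma Psi : 'M[R]_p) :
  let H := half_diff X in
  let W := invmx Gamma *m profile_Gamma H Psi in
  let N := sample_mean X - M in
  (0 < p)%N -> H \in unitmx -> spd Gamma -> spd Psi ->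
  likelihood X M Gamma Psi =
  likelihood_max H * (\det W * expR (p%:R - \tr W)) ^+ p *
  expR (- \tr (invmx Psi *m (N^T *m invmx Gamma *m N))).
Proof.
move=> H W N p0 uH sG sP.
have G0 := spd_det_gt0 sG; have P0 := spd_det_gt0 sP.
have H0 : \det H != 0 by rewrite -unitfE -unitmxE.
have pR0 : p%:R != 0 :> R by rewrite pnatr_eq0 -lt0n.
have trW : \tr (invmx Psi *m (H^T *m invmx Gamma *m H)) = p%:R * \tr W.
  rewrite /W /profile_Gamma -scalemxAr mxtraceZ mulrA mulfV// mul1r.
  rewrite -!mulmxA [RHS]mxtrace_mulC -!mulmxA [RHS]mxtrace_mulC.
  by rewrite -!mulmxA.
rewrite /likelihood sum_centered_quad -/(half_diff X) -/H -/N.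
rewrite -scalemxAr mxtraceZ mulNr mulrA mulVf ?pnatr_eq0// mul1r.
rewrite mulmxDr linearD/= opprD expRD trW -[- (p%:R * _)]mulrN expRM_natl.
rewrite mulrA; congr (_ * _).
have pi2 : 0 < 2 * pi :> R by rewrite mulr_gt0 ?pi_gt0.
rewrite /likelihood_max !powRN_half ?ltW//.
have -> : \det W = (\det Gamma)^-1 * (p%:R^-1 ^+ p * (\det H ^+ 2 / \det Psi)).
  rewrite /W /profile_Gamma det_mulmx detZ !det_mulmx !det_inv det_tr; ring.
rewrite -[p%:R - \tr W]addrC expRD !expRN.
rewrite -!mulrA; congr (_ * _).
(* All remaining factors are [p]-th powers, so it suffices to compare the bases. *)
rewrite -!exprVn -!exprMn; congr (_ ^+ p).
by field; rewrite H0 expf_neq0 ?invr_neq0// !gt_eqF ?expR_gt0.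
Qed.

Lemma likelihood_le (R : realType) (p : nat) (X : 'I_2 -> 'M[R]_p)
    (M Gamma Psi : 'M[R]_p) :
  (0 < p)%N -> half_diff X \in unitmx -> spd Gamma -> spd Psi ->
  likelihood X M Gamma Psi <= likelihood_max (half_diff X).
Proof.
move=> p0 uH sG sP; rewrite likelihoodE//.
have K0 := likelihood_max_gt0 p0 uH.
have sS := spd_profile_Gamma p0 uH sP.
have [W1 _] := spd_ratio_le1 sG sS; set W := (X in X ^+ p).
have W0 : 0 <= W.
  rewrite mulr_ge0 ?expR_ge0// det_mulmx det_inv.
  by rewrite mulr_ge0 ?invr_ge0 ?ltW// spd_det_gt0.
rewrite -mulrA ler_piMr ?(ltW K0)//; apply: mulr_ile1.
- exact: exprn_ge0.
- exact: expR_ge0.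
- exact: exprn_ile1.
- by rewrite -expR0 ler_expR oppr_le0; apply: mxtrace_spd_ge0; apply: spd_invmx.
Qed.

(** At the sample mean the factor involving [M] is 1, and taking [p]-th roots of nonnegative numbers
    leaves the equality case of the ratio bound. *)
Lemma likelihood_mean_max (R : realType) (p : nat) (X : 'I_2 -> 'M[R]_p)
    (Gamma Psi : 'M[R]_p) :
  (0 < p)%N -> half_diff X \in unitmx -> spd Gamma -> spd Psi ->
  (likelihood X (sample_mean X) Gamma Psi == likelihood_max (half_diff X)) =
  (Gamma == profile_Gamma (half_diff X) Psi).
Proof.
move=> p0 uH sG sP; rewrite likelihoodE//.
have K0 := likelihood_max_gt0 p0 uH.
have sS := spd_profile_Gamma p0 uH sP.
have [_ <-] := spd_ratio_le1 sG sS.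
rewrite subrr !mulmx0 mxtrace0 oppr0 expR0 mulr1.
rewrite -[X in _ == X]mulr1 (inj_eq (mulfI (lt0r_neq0 K0))).
rewrite -[X in _ == X](expr1n _ p) eqrXn2 ?ler01//.
rewrite mulr_ge0 ?expR_ge0// det_mulmx det_inv.
by rewrite mulr_ge0 ?invr_ge0 ?ltW// spd_det_gt0.
Qed.

(** A maximizer is compared with the profile point for the same [Psi], which attains the upper
    bound; the equality case then determines [Gamma]. *)
Lemma is_mleE (R : realType) (p : nat) (X : 'I_2 -> 'M[R]_p)
    (S : 'M[R]_(p * p)) :
  (0 < p)%N -> half_diff X \in unitmx ->
  is_mle X S <->
  exists2 Psi, spd Psi & S = Psi *t profile_Gamma (half_diff X) Psi.
Proof.
move=> p0 uH; split=> [[Gamma [Psi [sG sP -> maxL]]]|[Psi sP ->]].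
  exists Psi => //; congr (_ *t _); apply/eqP.
  have sG' := spd_profile_Gamma p0 uH sP.
  rewrite -likelihood_mean_max// eq_le likelihood_le//=.
  by rewrite (le_trans _ (maxL (sample_mean X) _ _ sG' sP))// le_eqVlt eq_sym
    likelihood_mean_max// eqxx.
have sG := spd_profile_Gamma p0 uH sP.
exists (profile_Gamma (half_diff X) Psi), Psi; split=> // M Gamma' Psi' sG' sP'.
have /eqP -> : likelihood X (sample_mean X) (profile_Gamma (half_diff X) Psi)
    Psi == likelihood_max (half_diff X) by rewrite likelihood_mean_max.
exact: likelihood_le.
Qed.

(* [Psi = 1] and [Psi = diag (2, 1, .., 1)] are not proportional, so they give
   different Kronecker products. *)
Lemma not_mle_unique (R : realType) (p : nat) (X : 'I_2 -> 'M[R]_p) :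
  (1 < p)%N -> half_diff X \in unitmx -> ~ mle_unique X.
Proof.
case: p X => [|[|p]]// X _ uH [S [_ uniqS]].
pose D : 'M[R]_p.+2 := diag_mx (\row_i (if i == ord0 then 2 else 1 : R)).
have sD : spd D.
  split=> [|v v0]; first exact: tr_diag_mx.
  apply: (lt_le_trans ((spd1 R p.+2).2 v v0)).
  rewrite mulmx1 !mxE; apply: ler_sum => i _; rewrite mul_mx_diag !mxE.
  rewrite -!expr2 mulrAC -expr2; case: ifP => _; last by rewrite mulr1.
  by rewrite ler_peMr ?sqr_ge0// ler1n.
have mle Psi : spd Psi -> S = Psi *t profile_Gamma (half_diff X) Psi.
  by move=> sP; apply: uniqS; apply/is_mleE => //; exists Psi.
have E : 1%:M *t profile_Gamma (half_diff X) 1%:M =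
    D *t profile_Gamma (half_diff X) D.
  by rewrite -(mle _ (spd1 R p.+2)) -(mle D sD).
pose B := profile_Gamma (half_diff X) D ord0 ord0.
have B0 : 0 < B by apply: spd_diag_gt0; exact: spd_profile_Gamma.
(* These entries are [Psi k k] times the corner of the second factor. The first and last [k] give
   [2 * B] and [B] for the same number, which contradicts [B0]. *)
have Ek k := congr1 (fun S : 'M[R]_(p.+2 * p.+2) =>
  S (mxtens_index (k, ord0)) (mxtens_index (k, ord0))) E.
have D0 : D ord0 ord0 = 2 by rewrite !mxE.
have D1 : D ord_max ord_max = 1 by rewrite !mxE eqxx.
have := Ek ord0; rewrite !tensmxE D0 [1%:M _ _]mxE eqxx mul1r => E0.
have := Ek ord_max; rewrite !tensmxE D1 [1%:M _ _]mxE eqxx !mul1r E0 -/B.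
by move=> /eqP; rewrite -subr_eq0 mulr_natl mulr2n addrK gt_eqF.
Qed.

(** * Null sets *)

Lemma measurable_det (d : measure_display) (T : measurableType d)
    (R : realType) (D : set T) (n : nat) (A : T -> 'M[R]_n) :
  (forall i j, measurable_fun D (fun x => A x i j)) ->
  measurable_fun D (fun x => \det (A x)).
Proof.
move=> mA; apply: measurable_sum => s; apply: measurable_funM.
  exact: measurable_cst.
exact: measurable_prod.
Qed.

Lemma measurable_zeros (d : measure_display) (T : measurableType d)
    (R : realType) (f : T -> R) :
  measurable_fun [set: T] f -> measurable [set x | f x = 0].
Proof.
move=> mf; rewrite -[X in measurable X]setTI.
exact: (mf measurableT [set 0] (measurable_set1 0)).
Qed.

Lemma measurable_mvnormal_pdf (R : realType) (m : nat) (mu : 'cV[R]_m)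
    (Sigma : 'M[R]_m) :
  measurable_fun [set: m.-tuple R]
    (fun t => mvnormal_pdf mu Sigma (of_coords t)).
Proof.
apply: measurable_funM; first exact: measurable_cst.
apply: measurableT_comp => //.
apply: measurable_funM; first exact: measurable_cst.
under eq_fun do rewrite mxE; apply: measurable_sum => j.
have mcoord i :
    measurable_fun [set: m.-tuple R] (fun t => tnth t i - mu i ord0).
  by apply: measurable_funB; [exact: measurable_tnth | exact: measurable_cst].
apply: measurable_funM; last by under eq_fun do rewrite !mxE; exact: mcoord.
under eq_fun do rewrite mxE; apply: measurable_sum => i.
apply: measurable_funM; last exact: measurable_cst.
by under eq_fun do rewrite !mxE; exact: mcoord.
Qed.

(** * Zero sets of functions polynomial on lines *)

Lemma finite_poly_zeros (R : realType) (p : {poly R}) :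
  p != 0 -> finite_set [set x | p.[x] = 0].
Proof.
move=> p0; apply: contrapT => /(@infinite_set_fset _ _ (size p))[B Bp].
rewrite leqNgt => /negP; apply; apply: max_poly_roots => //.
  by apply/allP => x xB; apply/eqP; exact: Bp.
exact: finmap.fset_uniq.
Qed.

(** This is all that the Fubini argument uses, and it is inherited by the slices with a fixed first
    coordinate. *)
Definition polynomial_on_lines (R : realType) (m : nat) (f : m.-tuple R -> R) :=
  forall u v : 'I_m -> R, exists p : {poly R},
    forall x, f [tuple u i + x * v i | i < m] = p.[x].

(** The tails [t] with [f] zero at [thead a :: t] form a null set [Z] by induction. For any other
    tail, [f] is a nonzero polynomial in the first coordinate, with finitely many zeros, and Fubini
    concludes. *)
Lemma lebesgue_tuple_zeros (R : realType) (m : nat) (f : m.-tuple R -> R)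
    (a : m.-tuple R) :
  measurable_fun [set: m.-tuple R] f -> polynomial_on_lines f -> f a != 0 ->
  lebesgue_tuple R m [set t | f t = 0] = 0%E.
Proof.
elim: m f a => [|m IHm] f a mf pf fa.
  rewrite (_ : [set t | f t = 0] = set0) ?measure0//.
  by apply/seteqP; split=> // t/=; rewrite (tuple0 t) -(tuple0 a); exact/eqP.
pose g x t := f (tuple_cons (t, x)).
have mg : measurable_fun [set: m.-tuple R * R] (fun z => g z.2 z.1).
  have mcons : measurable_fun [set: m.-tuple R * R] (@tuple_cons R m).
    exact: measurable_cons.
  exact: (measurableT_comp mf mcons).
pose Z := [set t | g (thead a) t = 0].
have mga : measurable_fun [set: m.-tuple R] (g (thead a)).
  exact: (measurable_fun_pair1 (thead a) mg).
have Z0 : lebesgue_tuple R m Z = 0%E.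
  apply: (IHm _ [tuple of behead a]) => //; last first.
    rewrite /g (_ : tuple_cons _ = a)//; apply: val_inj => /=.
    by rewrite [in RHS](tuple_eta a).
  (* A line in the slice is a line of the whole space with head [thead a] and direction of head
     0. *)
  move=> u v; have [p pE] := pf
    (fun i => if unlift ord0 i is Some j then u j else thead a)
    (fun i => if unlift ord0 i is Some j then v j else 0).
  exists p => x; rewrite -pE /g; congr f; apply: eq_from_tnth => i.
  rewrite tnth_mktuple; case: unliftP => [j ->|->].
    by rewrite tnthS tnth_mktuple.
  by rewrite tnth0 mulr0 addr0.
have mN := measurable_zeros mg.
rewrite /= /lebesgue_tupleS /pushforward.
transitivity (\int[lebesgue_tuple R m]_t cst 0 t)%E; last exact: integral0.
apply: ae_eq_integral => //.
- exact: (measurable_fun_xsection lebesgue_measure mN).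
- exists Z; split => //; first exact: measurable_zeros.
  move=> t/= /not_implyP[_] h; apply: contrapT => /= gt0; apply: h.
  have [p pE] := pf (fun i => if unlift ord0 i is Some j then tnth t j else 0)
    (fun i => if unlift ord0 i is Some j then 0 else 1).
  have gE x : g x t = p.[x].
    rewrite -pE /g; congr f; apply: eq_from_tnth => i.
    rewrite tnth_mktuple; case: unliftP => [j ->|->].
      by rewrite tnthS mulr0 addr0.
    by rewrite tnth0 add0r mulr1.
  apply: countable_lebesgue_measure0; apply: finite_set_countable.
  rewrite (_ : xsection _ _ = [set x | p.[x] = 0]); last first.
    by apply/seteqP; split=> x; rewrite /xsection/= inE/= -/(g _ _) gE.
  apply: finite_poly_zeros; apply/eqP => p0; apply: gt0.
  by rewrite /Z/= gE p0 horner0.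
Qed.

(** The determinant is taken over the polynomial ring; evaluation at [x] is a ring morphism and
    commutes with it. *)
Lemma det_line_poly (R : comNzRingType) (n : nat) (A B : 'M[R]_n) :
  exists p : {poly R}, forall x, \det (A + x *: B) = p.[x].
Proof.
exists (\det (map_mx polyC A + 'X *: map_mx polyC B)) => x.
rewrite -horner_evalE -det_map_mx; congr (\det _); apply/matrixP => i j.
by rewrite !mxE/= horner_evalE !hornerE.
Qed.

Definition mx_of_coords (R : realType) (p : nat) (t : (p * p).-tuple R) :
  'M[R]_p :=
  \matrix_(i, j) tnth t (mxtens_index (j, i)).

Lemma coords_vecK (R : realType) (p : nat) (M : 'M[R]_p) :
  mx_of_coords (coords (vec M)) = M.
Proof.
by apply/matrixP => i j; rewrite mxE tnth_mktuple mxE mxtens_indexK.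
Qed.

Lemma lebesgue_det_zeros (R : realType) (p : nat) (M : 'M[R]_p) :
  lebesgue_tuple R (p * p) [set t | \det (M - mx_of_coords t) = 0] = 0%E.
Proof.
(* At the point [M - 1%:M] the determinant is 1, so it does not vanish identically. *)
apply: (@lebesgue_tuple_zeros _ _ _ (coords (vec (M - 1%:M)))).
- apply: measurable_det => i j; under eq_fun do rewrite !mxE.
  by apply: measurable_funB; [exact: measurable_cst|exact: measurable_tnth].
- move=> u v.
  have [q qE] := det_line_poly (M - \matrix_(i, j) u (mxtens_index (j, i)))
    (- \matrix_(i, j) v (mxtens_index (j, i))).
  exists q => x; rewrite -qE; congr (\det _); apply/matrixP => i j.
  by rewrite !mxE tnth_mktuple mulrN opprD addrA.
- by rewrite coords_vecK subKr det1 oner_neq0.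
Qed.

(** * Null events and almost sure invertibility *)

Lemma mvnormal_null (d : measure_display) (T : measurableType d) (R : realType)
    (P : probability T R) (m : nat) (Y : T -> 'cV[R]_m) (mu : 'cV[R]_m)
    (Sigma : 'M[R]_m) (N : set (m.-tuple R)) :
  mvnormal P Y mu Sigma -> measurable N -> lebesgue_tuple R m N = 0%E ->
  P [set w | N (coords (Y w))] = 0%E.
Proof.
move=> [_ YE] mN N0; rewrite YE//; apply: null_set_integral => //.
apply/measurable_EFinP; apply: measurable_funTS; exact: measurable_mvnormal_pdf.
Qed.

(** Independence fixes the joint law on rectangles, so by uniqueness it is the product of the
    marginals; the measure of [N] is then the integral of its null sections. *)
Lemma independent2_null (d : measure_display) (T : measurableType d)
    (R : realType) (P : probability T R) (m : nat) (Y1 Y2 : T -> 'cV[R]_m)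
    (N : set (m.-tuple R * m.-tuple R)) :
  measurable_fun [set: T] (fun w => coords (Y1 w)) ->
  measurable_fun [set: T] (fun w => coords (Y2 w)) ->
  independent2 P Y1 Y2 -> measurable N ->
  (forall s, P [set w | N (s, coords (Y2 w))] = 0%E) ->
  P [set w | N (coords (Y1 w), coords (Y2 w))] = 0%E.
Proof.
move=> m1 m2 ind mN N0.
have m12 : measurable_fun [set: T] (fun w => (coords (Y1 w), coords (Y2 w))).
  exact: measurable_fun_pair.
pose f1 : {mfun T >-> m.-tuple R} := mfun_Sub (mem_set m1).
pose f2 : {mfun T >-> m.-tuple R} := mfun_Sub (mem_set m2).
pose f12 : {mfun T >-> (m.-tuple R * m.-tuple R)%type} :=
  mfun_Sub (mem_set m12).
pose P1 := distribution P f1; pose P2 := distribution P f2.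
pose P12 := distribution P f12.
have PE : (P1 \x P2)%E N = P12 N by apply: product_measure_unique.
transitivity ((P1 \x P2)%E N); first exact/esym/PE.
transitivity (\int[P1]_s cst 0 s)%E; last exact: integral0.
apply: eq_integral => s _ /=; rewrite -[RHS](N0 s).
by congr (P _); apply/seteqP; split => w; rewrite /xsection/= inE.
Qed.

Lemma mvnormal_diff_unitmx (d : measure_display) (T : measurableType d)
    (R : realType) (P : probability T R) (p : nat) (X1 X2 : T -> 'M[R]_p)
    (mu1 mu2 : 'cV[R]_(p * p)) (Sigma1 Sigma2 : 'M[R]_(p * p)) :
  mvnormal P (fun w => vec (X1 w)) mu1 Sigma1 ->
  mvnormal P (fun w => vec (X2 w)) mu2 Sigma2 ->
  independent2 P (fun w => vec (X1 w)) (fun w => vec (X2 w)) ->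
  P [set w | X1 w - X2 w \in unitmx] = 1%E.
Proof.
move=> h1 h2 ind.
pose f (st : (p * p).-tuple R * (p * p).-tuple R) :=
  \det (mx_of_coords st.1 - mx_of_coords st.2).
have mf : measurable_fun setT f.
  apply: measurable_det => i j; under eq_fun do rewrite !mxE.
  apply: measurable_funB.
    exact: measurableT_comp (measurable_tnth _) measurable_fst.
  exact: measurableT_comp (measurable_tnth _) measurable_snd.
have mN := measurable_zeros mf.
have P0 := independent2_null h1.1 h2.1 ind mN.
have {}P0 : P [set w | f (coords (vec (X1 w)), coords (vec (X2 w))) = 0] = 0%E.
  (* For fixed [s] the section is Lebesgue-null, hence null for the law of [X2], which has a
     density. *)
  apply: P0 => s; apply: (mvnormal_null h2 (N := [set t | f (s, t) = 0])).
    apply: measurable_zeros; exact: (measurable_fun_pair2 s mf).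
  exact (lebesgue_det_zeros (mx_of_coords s)).
have mE : measurable [set w | f (coords (vec (X1 w)), coords (vec (X2 w))) = 0].
  apply: measurable_zeros; apply: measurableT_comp => //.
  exact: (measurable_fun_pair h1.1 h2.1).
rewrite (_ : [set w | _] =
    ~` [set w | f (coords (vec (X1 w)), coords (vec (X2 w))) = 0]).
  by rewrite probability_setC// P0 sube0.
apply/seteqP; split => w /=;
  by rewrite /f/= !coords_vecK unitmxE unitfE => /eqP.
Qed.

(* For p = 1 the set of estimators is a singleton, hence the hypothesis
   [1 < p] of the last part. *)
Theorem mainTheorem2 (d : measure_display) (T : measurableType d)
    (R : realType) (P : probability T R) (p : nat) (hp : (0 < p)%N)
    (mu : 'cV[R]_(p * p)) (Gamma Psi : 'M[R]_p)
    (hGamma : spd Gamma) (hPsi : spd Psi)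
    (X : 'I_2 -> T -> 'M[R]_p)
    (hX : forall k, mvnormal P (fun w => vec (X k w)) mu (Psi *t Gamma))
    (hind : independent2 P (fun w => vec (X 0 w)) (fun w => vec (X 1 w))) :
  [/\ P [set w | X 0 w - X 1 w \in unitmx] = 1%E,
      forall w, X 0 w - X 1 w \in unitmx ->
        [set S | is_mle (fun k => X k w) S] =
        [set S | exists2 Psi' : 'M[R]_p, spd Psi' &
           S = Psi' *t (p%:R^-1 *: ((2^-1 *: X 0 w - 2^-1 *: X 1 w)
                 *m invmx Psi' *m (2^-1 *: X 0 w - 2^-1 *: X 1 w)^T))] &
      (1 < p)%N -> forall w, X 0 w - X 1 w \in unitmx ->
        ~ mle_unique (fun k => X k w)].
Proof.
have unit_half w : X 0 w - X 1 w \in unitmx ->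
    half_diff (fun k => X k w) \in unitmx.
  move=> uX; rewrite /half_diff -scalerBr unitmxZ// unitfE invr_eq0.
  by rewrite pnatr_eq0.
split=> [|w uX|p1 w uX].
- exact: mvnormal_diff_unitmx (hX 0) (hX 1) hind.
- apply/seteqP; split => S hS.
    exact: (is_mleE S hp (unit_half w uX)).1 hS.
  exact: (is_mleE S hp (unit_half w uX)).2 hS.
- exact: not_mle_unique p1 (unit_half _ uX).
Qed.
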